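(* Let $F$ be a field with a nontrivial valuation $v$ and value group $\Gamma$, let $E/F$ be a finite field extension, and let $w:E\to M\cup\{\infty\}$ be a quasi-valuation on $E$ with $w|_F=v$, where $M$ is a totally ordered abelian monoid containing $\Gamma$. Then the topology $T_w$ induced by $w$ on $E$ is Hausdorff.
   Context: A quasi-valuation on a ring $A$ is a function $w:A\to M\cup\{\infty\}$, where $M$ is a totally ordered abelian monoid (written additively, the order being compatible with addition) to which an element $\infty$ greater than all elements of $M$ is adjoined (with $m+\infty=\infty$), such that $w(0)=\infty$, $w(xy)\ge w(x)+w(y)$ and $w(x+y)\ge\min\{w(x),w(y)\}$ for all $x,y\in A$. $\Gamma$ is an ordered submonoid of $M$. Put $M^G=\{m\in M\mid \text{there exists } 0\ne y\in E \text{ with } m\le w(y)\}$, and for $x\in E$, $m\in M^G$ put $U_m(x)=\{y\in E\mid w(y-x)>m\}$. $T_w$ is the topology on $E$ with base $\{U_m(x)\mid x\in E,\ m\in M^G\}$. *)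

(* Defs.v *)
From HB Require Import structures.
From mathcomp Require Import all_boot all_order all_algebra all_field.
From mathcomp Require Import all_classical all_reals all_analysis.

Set Implicit Arguments.
Unset Strict Implicit.
Unset Printing Implicit Defensive.

Import Order.TTheory GRing.Theory.

Local Open Scope classical_set_scope.
Local Open Scope ring_scope.
Local Open Scope order_scope.

(* Totally ordered abelian monoids.  Compatibility is the weak one:
   cancellation is not required, so a < b need not give c + a < c + b.
   This is a record rather than a structure of the hierarchy because that
   cannot be extended upwards from Num.POrderedZmodule by a join of
   Order.Total and GRing.Nmodule; both are instead inferred on om_sort. *)
Record orderedMonoidType (d : Order.disp_t) := OrderedMonoid {
  om_order : orderType d;
  om_add : om_order -> om_order -> om_order;
  om_zero : om_order;
  om_addA : associative om_add;
  om_addC : commutative om_add;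
  om_add0 : left_id om_zero om_add;
  om_add_le : forall a b c, a <= b -> om_add c a <= om_add c b
}.

Definition om_sort (d : Order.disp_t) (M : orderedMonoidType d) : Type :=
  om_order M.
Coercion om_sort : orderedMonoidType >-> Sortclass.

Section OrderedMonoidInstances.
Context (d : Order.disp_t) (M : orderedMonoidType d).

HB.instance Definition _ := Order.Total.copy (om_sort M) (om_order M).
HB.instance Definition _ := GRing.isNmodule.Build (om_sort M)
  (@om_addA d M) (@om_addC d M) (@om_add0 d M).

Lemma om_leD2l (a b c : M) : a <= b -> c + a <= c + b.
Proof. exact: om_add_le. Qed.

End OrderedMonoidInstances.

Record orderedGroupType (d : Order.disp_t) := OrderedGroup {
  og_monoid :> orderedMonoidType d;
  og_opp : forall a : og_monoid, exists b : og_monoid, (b + a = 0)%R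
}.

(* M with a largest, absorbing element; None plays the role of infinity. *)
Definition with_infty (M : Type) : Type := option M.
Definition infty {M : Type} : with_infty M := None.
Definition fin {M : Type} (m : M) : with_infty M := Some m.

HB.instance Definition _ (M : choiceType) :=
  Choice.copy (with_infty M) (option M).

Section WithInftyOrder.
Context (d : Order.disp_t) (M : orderType d).
Implicit Types x y : with_infty M.

Definition winf_le x y :=
  match x, y with
  | _, None => true
  | None, Some _ => false
  | Some a, Some b => a <= b
  end.
Definition winf_lt x y := (y != x) && winf_le x y.

Lemma winf_le_anti : antisymmetric winf_le.
Proof. by move=> [a|] [b|] //= /le_anti ->. Qed.

Lemma winf_le_trans : transitive winf_le.
Proof. by move=> [a|] [b|] [c|] //=; exact: le_trans. Qed.

Lemma winf_le_total : total winf_le.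
Proof. by move=> [a|] [b|] //=; exact: le_total. Qed.

HB.instance Definition _ := Order.isOrder.Build d (with_infty M)
  (fun _ _ => erefl) (fun _ _ => erefl) (fun _ _ => erefl)
  winf_le_anti winf_le_trans winf_le_total.

Lemma fin_le (a b : M) : (fin a <= fin b) = (a <= b).
Proof. by []. Qed.

Lemma fin_lt_infty (a : M) : fin a < infty.
Proof. by []. Qed.

End WithInftyOrder.

Section WithInftyMonoid.
Context (M : nmodType).
Implicit Types x y : with_infty M.

Definition winf_add x y : with_infty M :=
  match x, y with
  | Some a, Some b => Some (a + b)%R
  | _, _ => None
  end.

Lemma winf_addA : associative winf_add.
Proof. by move=> [a|] [b|] [c|] //=; rewrite addrA. Qed.

Lemma winf_addC : commutative winf_add.
Proof. by move=> [a|] [b|] //=; rewrite addrC. Qed.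

Lemma winf_add0 : left_id (Some 0%R : with_infty M) winf_add.
Proof. by move=> [a|] //=; rewrite add0r. Qed.

HB.instance Definition _ := GRing.isNmodule.Build (with_infty M)
  winf_addA winf_addC winf_add0.

Lemma finD (a b : M) : fin (a + b) = fin a + fin b.
Proof. by []. Qed.

Lemma add_infty x : x + infty = infty.
Proof. by case: x. Qed.

End WithInftyMonoid.

(* The (Krull) valuations of F with value group Gamma. *)
Record valuation (F : fieldType) (d : Order.disp_t)
    (Gamma : orderedGroupType d) := Valuation {
  valuation_fun :> F -> with_infty Gamma;
  valuation_eq_infty : forall a, valuation_fun a = infty <-> a = 0%R;
  valuationM : forall a b,
    valuation_fun (a * b) = valuation_fun a + valuation_fun b;
  valuationD : forall a b,
    Order.min (valuation_fun a) (valuation_fun b) <= valuation_fun (a + b);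
  valuation_surj : forall g : Gamma, exists a, valuation_fun a = fin g
}.

Definition nontrivial_valuation (F : fieldType) (d : Order.disp_t)
    (Gamma : orderedGroupType d) (v : valuation F Gamma) : Prop :=
  exists2 a, a != 0%R & v a != fin 0%R.

Record quasi_valuation (A : nzRingType) (d : Order.disp_t)
    (M : orderedMonoidType d) := QuasiValuation {
  qval_fun :> A -> with_infty M;
  qval0 : qval_fun 0%R = infty;
  qvalM : forall x y, qval_fun x + qval_fun y <= qval_fun (x * y);
  qvalD : forall x y, Order.min (qval_fun x) (qval_fun y) <= qval_fun (x + y)
}.

(* i presents Gamma as an ordered submonoid of M. *)
Definition order_embedding (dG dM : Order.disp_t)
    (Gamma : orderedMonoidType dG) (M : orderedMonoidType dM)
    (i : Gamma -> M) : Prop :=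
  forall a b, (i a <= i b) = (a <= b).

Definition extends_valuation (F : fieldType) (E : fieldExtType F)
    (dG dM : Order.disp_t) (Gamma : orderedGroupType dG)
    (M : orderedMonoidType dM) (i : Gamma -> M)
    (v : valuation F Gamma) (w : quasi_valuation E M) : Prop :=
  forall a : F, w (a%:A)%R = omap i (v a).

(* E carrying the topology T_w *)
Definition qv_space (E : nzRingType) (d : Order.disp_t)
  (M : orderedMonoidType d) (w : quasi_valuation E M) : Type := E.

Section QuasiValuationTopology.
Context (E : nzRingType) (d : Order.disp_t) (M : orderedMonoidType d).
Variable w : quasi_valuation E M.

HB.instance Definition _ := Choice.copy (qv_space w) E.

Definition qv_radius : set M :=
  [set m | exists2 y : E, y != 0%R & fin m <= w y].

Definition qv_ball (m : M) (x : E) : set E := [set y | fin m < w (y - x)].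

(* (m, x) indexes the basic open set U_m(x). *)
Definition qv_index : Type := (M * E)%type.
HB.instance Definition _ := Choice.copy qv_index (M * E)%type.
HB.instance Definition _ := isPointed.Build qv_index (0%R, 0%R).

Definition qv_base_dom : set qv_index := [set p | qv_radius p.1].
Definition qv_base (p : qv_index) : set (qv_space w) := qv_ball p.1 p.2.

Lemma qv_ball_center m x : qv_ball m x x.
Proof. by rewrite /qv_ball /= subrr qval0 fin_lt_infty. Qed.

Lemma qv_ball_le m n x z : n <= m -> qv_ball n x z ->
  qv_ball m z `<=` qv_ball n x.
Proof.
rewrite /qv_ball /= => nm zx y /= yz.
have -> : (y - x = (y - z) + (z - x))%R by rewrite addrA subrK.
apply: lt_le_trans (qvalD _ _ _); rewrite lt_min zx andbT.
by apply: le_lt_trans yz; rewrite fin_le.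
Qed.

Lemma qv_base_cover : \bigcup_(p in qv_base_dom) qv_base p = setT.
Proof.
apply/seteqP; split=> // x _.
suff [m Gm] : exists m, qv_radius m.
  by exists (m, x) => //; exact: qv_ball_center.
case w1: (w 1%R) => [m|].
  by exists m; exists 1%R; rewrite ?oner_neq0 // w1.
by exists 0%R; exists 1%R; rewrite ?oner_neq0 // w1.
Qed.

Lemma qv_base_join (p q : qv_index) (t : qv_space w) :
  qv_base_dom p -> qv_base_dom q -> qv_base p t -> qv_base q t ->
  exists r, [/\ qv_base_dom r, qv_base r t &
                qv_base r `<=` qv_base p `&` qv_base q].
Proof.
case: p q => [m x] [n y] Gm Gn pt qt; exists (Order.max m n, t); split.
- by rewrite /qv_base_dom /=; case: (leP m n).
- exact: qv_ball_center.
- move=> z zt; split; [move: pt | move: qt] => h.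
    by apply: (qv_ball_le _ h zt); rewrite /= le_max lexx.
  by apply: (qv_ball_le _ h zt); rewrite /= le_max lexx orbT.
Qed.

HB.instance Definition _ :=
  isBaseTopological.Build (qv_space w) qv_base_cover qv_base_join.

End QuasiValuationTopology.

(* Main.v *)
Require Import Defs.
From HB Require Import structures.
From mathcomp Require Import all_boot all_order all_algebra all_field.
From mathcomp Require Import all_classical all_reals all_analysis.

(** Two distinct points x and y of E are separated by the balls of radius
    m = w (y - x) around them: a common point t of U_m(x) and U_m(y) would
    give, by the triangle inequality applied to y - x = (t - x) - (t - y),
    the contradiction w (y - x) > m.

    For this to make sense m has to be an element of M, that is, w must not
    take the value infinity at a nonzero z.  It cannot: E is a field, so
    w 1 = w (z * z^-1) >= w z + w z^-1 would be infinite, whereas w 1 = v 1 is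
    finite.  That m belongs to M^G is then witnessed by y - x itself.

    The triangle inequality for differences needs w (- z) = w z.  A
    quasi-valuation need not be even; here it is, because
    w (- z) >= w (-1) + w z and w (-1) = v (-1) = 0: the ordered group Gamma
    has no element of order two. *)

Import Order.TTheory GRing.Theory.
Local Open Scope classical_set_scope.
Local Open Scope ring_scope.
Local Open Scope order_scope.

(** Without cancellation, the order still forces this: adding g to itself moves
    it weakly away from 0. *)
Lemma om_add_self_eq0 (d : Order.disp_t) (M : orderedMonoidType d) (g : M) :
  g + g = 0%R -> g = 0%R.
Proof.
move=> gg; apply/eqP; rewrite eq_le; case/orP: (le_total g 0%R) => g0.
  by rewrite g0 /= -gg -{3}[g]addr0 om_leD2l.
by rewrite g0 andbT -gg -{1}[g]addr0 om_leD2l.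
Qed.

Lemma og_add_idem (d : Order.disp_t) (Gamma : orderedGroupType d) (g : Gamma) :
  g + g = g -> g = 0%R.
Proof. by move=> gg; have [h hg] := og_opp g; rewrite -[LHS]add0r -hg -addrA gg. Qed.

Lemma valuation1 (F : fieldType) (d : Order.disp_t)
    (Gamma : orderedGroupType d) (v : valuation F Gamma) : v 1%R = fin 0%R.
Proof.
have := valuationM v 1%R 1%R; rewrite mulr1.
case v1 : (v 1%R) => [g|]; last first.
  by move/(valuation_eq_infty v): v1 => /eqP; rewrite oner_eq0.
by case=> /esym /og_add_idem ->.
Qed.

Lemma valuationN1 (F : fieldType) (d : Order.disp_t)
    (Gamma : orderedGroupType d) (v : valuation F Gamma) :
  v (-1)%R = fin 0%R.
Proof.
have := valuationM v (-1)%R (-1)%R; rewrite mulrNN mulr1 valuation1.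
by case: (v (-1)%R) => [g|] //= [] /esym /om_add_self_eq0 ->.
Qed.

(** One inequality is enough, as negation is an involution. *)
Lemma qvalN (A : nzRingType) (d : Order.disp_t) (M : orderedMonoidType d)
    (w : quasi_valuation A M) : w (-1)%R = fin 0%R -> forall x, w (- x)%R = w x.
Proof.
move=> wN1; have leN x : w x <= w (- x)%R.
  by have := qvalM w (-1)%R x; rewrite wN1 mulN1r add0r.
by move=> x; apply/eqP; rewrite eq_le leN andbT -{2}[x]opprK leN.
Qed.

(** An invertible element of infinite value would make 1 infinite too. *)
Lemma qval_eq_infty (E : fieldType) (d : Order.disp_t)
    (M : orderedMonoidType d) (w : quasi_valuation E M) :
  w 1%R != infty -> forall x, w x = infty -> x = 0%R.
Proof.
move=> w1 x wx; apply/eqP; apply: contraNT w1 => x0.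
have := qvalM w x^-1%R x; rewrite mulVf // wx add_infty.
by case: (w 1%R).
Qed.

Lemma open_qv_ball (A : nzRingType) (d : Order.disp_t)
    (M : orderedMonoidType d) (w : quasi_valuation A M) (m : M) (x : A) :
  qv_radius w m -> open (qv_ball w m x : set (qv_space w)).
Proof.
move=> Gm; exists [set (m, x)]; first by move=> _ ->.
by rewrite bigcup_set1.
Qed.

(** The first hypothesis turns w (y - x) into an element of M that can serve as
    a radius, the second gives the triangle inequality for differences. *)
Lemma qv_space_hausdorff (A : nzRingType) (d : Order.disp_t)
    (M : orderedMonoidType d) (w : quasi_valuation A M) :
  (forall x, w x = infty -> x = 0%R) -> (forall x, w (- x)%R = w x) ->
  hausdorff_space (qv_space w).
Proof.
move=> w_infty wN; rewrite open_hausdorff => x y xy.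
have yx0 : (y - x != 0 :> A)%R by rewrite subr_eq0 eq_sym.
case wyx : (w (y - x)%R) => [m|]; last first.
  by move/w_infty/eqP: wyx; rewrite (negbTE yx0).
have Gm : qv_radius w m by exists (y - x)%R => //; rewrite wyx.
exists (qv_ball w m x, qv_ball w m y).
  by split; apply/mem_set; exact: qv_ball_center.
split; [exact: open_qv_ball | exact: open_qv_ball |].
apply/eqP/seteqP; split=> // t [] /= xt yt.
have : fin m < w (y - x)%R.
  have -> : (y - x = (t - x) - (t - y) :> A)%R by rewrite opprB [RHS]addrC subrKA.
  by apply: lt_le_trans (qvalD w _ _); rewrite lt_min xt wN.
by rewrite wyx ltxx.
Qed.

Theorem proposition2p10 (F : fieldType) (E : fieldExtType F)
    (dG dM : Order.disp_t)
    (Gamma : orderedGroupType dG) (M : orderedMonoidType dM)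
    (i : {additive Gamma -> M}) (hi : order_embedding i)
    (v : valuation F Gamma) (hv : nontrivial_valuation v)
    (w : quasi_valuation E M) (hw : extends_valuation i v w) :
  hausdorff_space (qv_space w).
Proof.
have w1 : w 1%R = fin 0%R.
  by rewrite -(scale1r 1%R) hw valuation1 /= raddf0.
have wN1 : w (-1)%R = fin 0%R.
  by rewrite -(scaleN1r 1%R) hw valuationN1 /= raddf0.
apply: qv_space_hausdorff; last exact: qvalN.
by apply: qval_eq_infty; rewrite w1.
Qed.
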